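(* For the reordering buffer management problem, the greedy algorithm (which changes its active colour only when necessary, and then to a colour that has the maximum number of items in the buffer) is bijectively optimal: for every $n$ and every online algorithm $B$ there is a bijection $\pi:\mathcal{I}_n\to\mathcal{I}_n$ with $\textsc{greedy}(\sigma)\le B(\pi(\sigma))$ for all $\sigma\in\mathcal{I}_n$.
   Context: Reordering buffer management: a service station has an active colour, and there is an initially empty buffer of capacity $k$. A request sequence is a sequence of coloured items (colours from a finite set) which enter the buffer in order, the next item entering as soon as a slot is free. Items in the buffer whose colour equals the active colour can be served (removed from the buffer). If no item in the buffer has the active colour, the station must change its active colour, at unit cost. All items must eventually be served; the cost $A(\sigma)$ of an algorithm is its number of colour switches. $\mathcal{I}_n$ is the set of all request sequences of $n$ items. *)

(* Defs.v *)
From mathcomp Require Import all_boot.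
Set Implicit Arguments.
Unset Strict Implicit.
Unset Printing Implicit Defensive.

Inductive action (C : Type) := Serve | Switch of C.
Arguments Serve {C}.

Definition is_switch (C : Type) (a : action C) : bool :=
  if a is Switch _ then true else false.

(* Everything an online algorithm may observe: the active colour ([None] if the
   station has not been set to any colour yet), the colours of the items in the
   buffer, the colours of all the items that have entered so far, and the
   actions performed so far. *)
Record station (C : Type) := Station {
  active : option C;
  buffer : seq C;
  entered : seq C;
  past : seq (action C)
}.

(* The unobserved part is the sequence of items that have yet to enter. *)
Record config (C : Type) := Config {
  visible :> station C;
  pending : seq C
}.

(* Items enter in order until the buffer is full or the input is exhausted;
   this happens before every decision. *)
Definition admit_items (C : Type) (k : nat) (cf : config C) : config C :=
  let m := k - size (buffer cf) in
  let new := take m (pending cf) in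
  Config (Station (active cf) (buffer cf ++ new) (entered cf ++ new) (past cf))
         (drop m (pending cf)).

Definition start (C : Type) (k : nat) (a0 : option C) (s : seq C) : config C :=
  admit_items k (Config (Station a0 [::] [::] [::]) s).

Definition finished (C : Type) (cf : config C) : bool :=
  nilp (buffer cf) && nilp (pending cf).

Definition can_serve (C : eqType) (st : station C) : bool :=
  if active st is Some c then c \in buffer st else false.

(* The station may be switched at any time, even if items of the active colour
   remain in the buffer, and to any other colour. *)
Definition legal (C : eqType) (st : station C) (a : action C) : bool :=
  match a with
  | Serve => can_serve st
  | Switch c => active st != Some c
  end.

Definition act (C : eqType) (st : station C) (a : action C) : station C :=
  let past' := rcons (past st) a in
  match a with
  | Serve =>
      let buffer' :=
        if active st is Some c then rem c (buffer st) else buffer st in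
      Station (active st) buffer' (entered st) past'
  | Switch c => Station (Some c) (buffer st) (entered st) past'
  end.

Definition step (C : eqType) (k : nat) (f : station C -> action C)
    (cf : config C) : config C :=
  if finished cf then cf
  else admit_items k (Config (act cf (f cf)) (pending cf)).

Definition run (C : eqType) (k : nat) (a0 : option C)
    (f : station C -> action C) (s : seq C) (m : nat) : config C :=
  iter m (step k f) (start k a0 s).

(* A (deterministic) online algorithm for capacity [k] and initial active
   colour [a0]. *)
Record online_algorithm (C : eqType) (k : nat) (a0 : option C) := OnlineAlgorithm {
  decide :> station C -> action C;
  decide_legal : forall (s : seq C) (m : nat),
    let cf := run k a0 decide s m in ~~ finished cf -> legal cf (decide cf);
  decide_serves_all : forall s : seq C, exists m, finished (run k a0 decide s m)
}.

Definition cost (C : eqType) (k : nat) (a0 : option C)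
    (A : online_algorithm k a0) (s : seq C) : nat :=
  count (@is_switch C)
    (past (run k a0 A s (ex_minn (decide_serves_all A s)))).

(* Ties between colours of maximum multiplicity are broken arbitrarily. *)
Definition greedy (C : eqType) (k : nat) (a0 : option C)
    (A : online_algorithm k a0) : Prop :=
  forall (s : seq C) (m : nat),
    let cf := run k a0 A s m in
    ~~ finished cf ->
    if can_serve cf then A cf = Serve
    else exists2 c : C, A cf = Switch c &
           forall d : C, count_mem d (buffer cf) <= count_mem c (buffer cf).

(* Main.v *)
Require Import Defs.
From mathcomp Require Import all_boot.
From mathcomp Require Import perm zify.
Set Implicit Arguments.
Unset Strict Implicit.
Unset Printing Implicit Defensive.

(** Only the multiset of buffered colours, the active colour and the number of
    pending items matter.  Let [wins r t x a] be the optimal number of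
    continuations of length [r] that can be finished with at most [t] further
    switches from the buffer [x] with active colour [a].  Two facts are proved
    by simultaneous induction on [r]: recolouring a buffered item with the
    active colour does not decrease [wins] ([wins_recolour]), and one extra
    switch compensates for any choice of the active colour ([wins_switch]).
    By symmetry under renaming colours, the first fact implies that the more
    frequent of two colours is the better one to switch to.  Hence [wins]
    bounds the number of cheap sequences from above for every algorithm and
    from below for greedy.  Comparing these numbers at every threshold and
    matching the sequences in the order of their costs gives the bijection. *)

(** * Matching two functions on a finite type by rank *)

Section SortedMatching.
Variable T : finType.
Implicit Types f g : T -> nat.

Let ordered f : seq T := sort (relpre f leq) (enum T).

Let ordered_perm f : perm_eq (ordered f) (enum T).
Proof. by rewrite /ordered perm_sort. Qed.

Let ordered_uniq f : uniq (ordered f).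
Proof. by rewrite sort_uniq enum_uniq. Qed.

Let mem_ordered f x : x \in ordered f.
Proof. by rewrite mem_sort mem_enum. Qed.

Let size_ordered f : size (ordered f) = #|T|.
Proof. by rewrite size_sort -cardE. Qed.

Let card_le f t : #|[pred x | f x <= t]| = count (fun x => f x <= t) (ordered f).
Proof.
by rewrite cardE /enum_mem size_filter; apply/esym/seq.permP;
   rewrite perm_sort enumT.
Qed.

Let ordered_mono f x0 i j : i <= j -> j < #|T| ->
  f (nth x0 (ordered f) i) <= f (nth x0 (ordered f) j).
Proof.
move=> le_ij lt_j.
have tr : transitive (relpre f leq) by move=> a b c /=; apply: leq_trans.
have rf : reflexive (relpre f leq) by move=> a /=.
have st : sorted (relpre f leq) (ordered f).
  by apply: sort_sorted => a b /=; apply: leq_total.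
apply: (sorted_leq_nth tr rf x0 st) => //; rewrite inE size_ordered //.
exact: leq_ltn_trans lt_j.
Qed.

(** Elements of equal rank in the orders by [f] and by [g] are matched. If at rank [i] the value of
    [f] exceeded the value [t] of [g], at most [i] elements would have [f] at most [t], while at
    least [i.+1] have [g] at most [t]. *)
Lemma bijection_of_dominated_levels f g :
  (forall t, #|[pred x | g x <= t]| <= #|[pred x | f x <= t]|) ->
  exists pi : T -> T, bijective pi /\ forall x, f x <= g (pi x).
Proof.
move=> le_gf.
pose sf := ordered f; pose sg := ordered g.
(* The argument [x] itself is the default of [nth], as [T] may be empty; the index is always in
   range, so the default is never returned. *)
exists (fun x => nth x sg (index x sf)); split.
  exists (fun y => nth y sf (index y sg)) => x.
    rewrite index_uniq ?ordered_uniq //; last first.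
      by rewrite size_ordered -(size_ordered f) index_mem mem_ordered.
    by rewrite (set_nth_default x) ?nth_index ?mem_ordered // index_mem mem_ordered.
  rewrite index_uniq ?ordered_uniq //; last first.
    by rewrite size_ordered -(size_ordered g) index_mem mem_ordered.
  by rewrite (set_nth_default x) ?nth_index ?mem_ordered // index_mem mem_ordered.
move=> x; set i := index x sf.
have lt_i : i < #|T| by rewrite -(size_ordered f) index_mem mem_ordered.
rewrite leqNgt; apply/negP => lt_gf.
have := le_gf (g (nth x sg i)); rewrite leqNgt => /negP; apply.
rewrite !card_le -/sf -/sg.
set t := g _ in lt_gf *.
apply: (@leq_ltn_trans i).
  rewrite -(cat_take_drop i sf) count_cat.
  have -> : count (fun y => f y <= t) (drop i sf) = 0.
    apply/eqP; rewrite -leqn0 leqNgt -has_count; apply/negP => /(has_nthP x).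
    case=> j; rewrite size_drop size_ordered nth_drop => lt_j.
    rewrite leqNgt => /negP; apply; apply: (leq_trans lt_gf).
    rewrite -[X in f X](nth_index x (mem_ordered f x)) -/sf -/i.
    apply: ordered_mono; lia.
  rewrite addn0; apply: leq_trans (count_size _ _) _.
  by rewrite size_take; case: ifP => //; lia.
rewrite -(cat_take_drop i.+1 sg) count_cat.
have -> : count (fun y => g y <= t) (take i.+1 sg) = i.+1.
  rewrite -[RHS](@size_takel i.+1 _ sg) ?size_ordered //.
  apply/eqP; rewrite -all_count; apply/(all_nthP x) => j.
  rewrite size_takel ?size_ordered // => lt_j.
  by rewrite nth_take //; apply: ordered_mono.
exact: leq_addr.
Qed.

End SortedMatching.

Lemma leq_nat_of_bool (b1 b2 : bool) : (b1 -> b2) -> b1 <= b2.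
Proof. by case: b1 b2 => [] [] // /(_ isT). Qed.

(** * The optimal number of cheap continuations, as a function of multiplicities *)

Section OptimalCount.
Variable C : finType.
Implicit Types (x : {ffun C -> nat}) (a : option C) (c d e : C) (r t : nat).

(** Used in two roles: serving a [d] while a [c] enters, and recolouring a buffered [d] as [c]. *)
Definition replace_item x d c : {ffun C -> nat} :=
  [ffun e => x e - (e == d) + (e == c)].

(** Once nothing is pending, this is exactly the number of switches still needed. *)
Definition other_colours x a : nat := #|[pred c | (Some c != a) && (0 < x c)]|.

Definition available x a : bool := if a is Some c then 0 < x c else false.

(** The colour [d] is chosen before the entering item [e] is known, so the maximum stands outside
    the sum. A switch is merged with the serve after it, which makes the recursion structural in
    [r]. *)
Fixpoint wins r t x a : nat :=
  if r is r'.+1 then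
    let serve t' c := \sum_e wins r' t' (replace_item x c e) (Some c) in
    match a with
    | Some c => if 0 < x c then serve t c else
        if t is t'.+1 then \max_(d | 0 < x d) serve t' d else 0
    | None => if t is t'.+1 then \max_(d | 0 < x d) serve t' d else 0
    end
  else other_colours x a <= t.

Lemma wins_serve r t x c : 0 < x c ->
  wins r.+1 t x (Some c) = \sum_e wins r t (replace_item x c e) (Some c).
Proof. by move=> /= ->. Qed.

(** Splits the merged step of [wins] back into a switch and a serve. *)
Lemma wins_stuck r t x a : ~~ available x a ->
  wins r.+1 t x a =
  if t is t'.+1 then \max_(d | 0 < x d) wins r.+1 t' x (Some d) else 0.
Proof.
move=> na; case: t => [|t]; first by case: a na => //= c /negPf ->.
rewrite (eq_bigr _ (fun d xd => wins_serve r t xd)).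
by case: a na => //= c /negPf ->.
Qed.

Lemma wins_leS r t x a : wins r t x a <= wins r t.+1 x a.
Proof.
elim: r t x a => [|r IH] t x a.
  by apply: leq_nat_of_bool; apply: leqW.
case av : (available x a).
  case: a av => // c xc; rewrite !wins_serve //; apply: leq_sum => e _; exact: IH.
rewrite !wins_stuck ?av //; case: t => // t.
apply/bigmax_leqP => d xd.
apply: leq_trans (leq_bigmax_cond _ xd).
by rewrite !wins_serve //; apply: leq_sum => e _; exact: IH.
Qed.

Lemma wins_bound r t x a : wins r t x a <= #|C| ^ r.
Proof.
elim: r t x a => [|r IH] t x a; first exact: leq_b1.
have serve t' c : 0 < x c -> wins r.+1 t' x (Some c) <= #|C| ^ r.+1.
  move=> xc; rewrite wins_serve // expnS -sum_nat_const.
  by apply: leq_sum => e _; exact: IH.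
case av : (available x a); first by case: a av => // c xc; exact: serve.
by rewrite wins_stuck ?av //; case: t => // t; apply/bigmax_leqP => d; exact: serve.
Qed.

Lemma replace_itemxx x c : 0 < x c -> replace_item x c c = x.
Proof. by move=> xc; apply/ffunP => e; rewrite ffunE; case: eqVneq => [->|_]; lia. Qed.

(* Serving [c] or [d] first leaves buffers that differ by one recolouring. *)
Lemma replace_itemC x c d e : 0 < x c -> 0 < x d -> c != d ->
  replace_item (replace_item x d e) c d = replace_item x c e.
Proof.
move=> xc xd ncd; apply/ffunP => b; rewrite !ffunE.
case: (eqVneq b c) => [->|_]; first by rewrite (negPf ncd); lia.
by case: (eqVneq b d) => [->|_]; lia.
Qed.

Lemma other_colours_recolour x c d :
  other_colours (replace_item x d c) (Some c) <= other_colours x (Some c).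
Proof.
apply: subset_leq_card; apply/subsetP => e; rewrite !inE ffunE.
case/andP=> ne; rewrite ne /=; have -> : (e == c) = false.
  by apply: contraNF ne => /eqP ->.
lia.
Qed.

Lemma other_colours_switch x a b : other_colours x a <= (other_colours x b).+1.
Proof.
case: b => [c|]; last first.
  apply: leqW; apply: subset_leq_card; apply/subsetP => e; rewrite !inE.
  by case/andP.
rewrite /other_colours (cardD1 c).
apply: (@leq_add _ _ 1); first by case: (_ \in _).
apply: subset_leq_card; apply/subsetP => e; rewrite !inE.
by case/and3P => ne _ ->; rewrite andbT; apply: contraNneq ne => -[->].
Qed.

(** The two facts need each other: after serving different colours the buffers differ by one
    recolouring, and recolouring into an absent active colour saves a switch. *)
Lemma wins_recolour_switch r :
  (forall t x c d, 0 < x d ->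
     wins r t x (Some c) <= wins r t (replace_item x d c) (Some c)) /\
  (forall t x a b, wins r t x b <= wins r t.+1 x a).
Proof.
elim: r => [|r [IHrec IHsw]].
  split=> [t x c d _|t x a b] /=.
    by apply: leq_nat_of_bool; apply: leq_trans (other_colours_recolour x c d).
  by apply: leq_nat_of_bool => le_t; apply: leq_trans (other_colours_switch x a b) _.
have recolour t x c d e : 0 < x d -> 0 < x c ->
    wins r t (replace_item x c e) (Some c) <= wins r t (replace_item x d e) (Some c).
  move=> xd xc; have [->//|ndc] := eqVneq d c.
  rewrite -(@replace_itemC x d c e) //; apply: IHrec; rewrite ffunE (negPf ndc); lia.
have sw_pos t x c d : 0 < x c -> 0 < x d ->
    wins r.+1 t x (Some d) <= wins r.+1 t.+1 x (Some c).
  move=> xc xd; rewrite !wins_serve //; apply: leq_sum => e _.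
  (* Two moves: with [d] still active, exchange the served [d] for a served [c]; then let the extra
     switch pay for the active colour [c]. *)
  by apply: leq_trans (IHsw _ _ _ (Some d)); apply: recolour.
split=> [t x c d xd|t x a b].
  have [edc|ndc] := eqVneq d c; first by rewrite edc replace_itemxx // -edc.
  have xc' : 0 < replace_item x d c c by rewrite ffunE eqxx; lia.
  rewrite [leqRHS]wins_serve //.
  (* If [c] is absent from [x], the left side must first switch to some [m], whereas the right side
     serves the recoloured item at once and keeps that switch in hand. *)
  case: (posnP (x c)) => [xc0|xc].
    rewrite wins_stuck; last by rewrite /= xc0.
    case: t => // t.
    apply/bigmax_leqP => m xm; rewrite wins_serve //; apply: leq_sum => e _.
    have -> : replace_item (replace_item x d c) c e = replace_item x d e.
      apply/ffunP => b; rewrite !ffunE; case: (eqVneq b c) => [->|_]; last by lia.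
      by rewrite eq_sym (negPf ndc); lia.
    by apply: leq_trans (IHsw _ _ _ (Some m)); apply: recolour.
  rewrite wins_serve //; apply: leq_sum => e _.
  have -> : replace_item (replace_item x d c) c e = replace_item (replace_item x c e) d c.
    rewrite replace_itemC //; apply/ffunP => b; rewrite !ffunE.
    by case: (eqVneq b c) => [->|_]; lia.
  by apply: IHrec; rewrite ffunE (negPf ndc); lia.
have max_le t' c : 0 < x c ->
    \max_(d | 0 < x d) wins r.+1 t' x (Some d) <= wins r.+1 t'.+1 x (Some c).
  by move=> xc; apply/bigmax_leqP => d; apply: sw_pos.
(* If [a] can be served, [sw_pos] or [max_le] applies; if only [b] can, the extra switch goes to it;
   if neither can, both sides maximise over the same colours. *)
case ava : (available x a); case avb : (available x b).
- by case: a ava => // c xc; case: b avb => // d xd; apply: sw_pos.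
- case: a ava => // c xc; rewrite wins_stuck ?avb //; case: t => // t.
  exact: leq_trans (max_le _ _ xc) (wins_leS _ _ _ _).
- case: b avb => // d xd; rewrite [leqRHS]wins_stuck ?ava //.
  exact: (leq_bigmax_cond (F := fun d => wins r.+1 t x (Some d))).
- apply: leq_trans (wins_leS _ _ _ _) _.
  by rewrite [leqLHS]wins_stuck ?avb // [leqRHS]wins_stuck ?ava.
Qed.

Definition wins_recolour r := (wins_recolour_switch r).1.
Definition wins_switch r := (wins_recolour_switch r).2.

(** Colours enter [wins] only through equality, so its sums and maxima can be reindexed along
    [s]. *)
Lemma wins_rename (s : {perm C}) r t x a :
  wins r t [ffun e => x (s e)] a = wins r t x (omap s a).
Proof.
elim: r t x a => [|r IH] t x a.
  congr (nat_of_bool (_ <= _)); rewrite /other_colours -(card_imset _ (@perm_inj _ s)).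
  apply: eq_card => c; rewrite !inE; apply/imsetP/idP => [[d]|].
    rewrite !inE ffunE => /andP[nd xd] ->; rewrite xd andbT.
    by case: a nd => //= b; apply: contraNneq => -[/perm_inj ->].
  case/andP=> nc xc; exists ((s^-1)%g c); last by rewrite permKV.
  rewrite !inE ffunE permKV xc andbT.
  by case: a nc => //= b; apply: contraNneq => -[<-]; rewrite permKV.
have serve t' c : 0 < x (s c) ->
    wins r.+1 t' [ffun e => x (s e)] (Some c) = wins r.+1 t' x (Some (s c)).
  move=> xc; rewrite !wins_serve ?ffunE //.
  rewrite [RHS](reindex_inj (@perm_inj _ s)); apply: eq_bigr => e _.
  rewrite -(IH _ _ (Some c)); congr (wins r t' _ _); apply/ffunP => b.
  by rewrite !ffunE !(inj_eq perm_inj).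
have avE : available [ffun e => x (s e)] a = available x (omap s a).
  by case: a => //= c; rewrite ffunE.
case av : (available x (omap s a)).
  by case: a av avE => // c xc _; apply: serve.
rewrite !wins_stuck ?avE ?av //; case: t => // t.
rewrite [RHS](reindex_inj (@perm_inj _ s)).
by apply: eq_big => [d|d]; rewrite ffunE //; apply: serve.
Qed.

Lemma wins_recolourn j r t x c d : c != d -> j <= x d ->
  wins r t x (Some c) <=
  wins r t [ffun e => x e - j * (e == d) + j * (e == c)] (Some c).
Proof.
move=> ncd; elim: j => [|j IH] le_j.
  by under eq_ffun => e do rewrite !mul0n subn0 addn0; rewrite ffunK.
apply: leq_trans (IH (ltnW le_j)) _.
set y := finfun _.
have -> : [ffun e => x e - j.+1 * (e == d) + j.+1 * (e == c)] = replace_item y d c.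
  apply/ffunP => e; rewrite !ffunE.
  case: (eqVneq e c) => [->|_]; first by rewrite (negPf ncd); lia.
  by case: (eqVneq e d) => [->|_]; lia.
by apply: wins_recolour; rewrite !ffunE eqxx eq_sym (negPf ncd); lia.
Qed.

(** Transposing [c] and [d] makes [c] the active colour on the left as well. The transposed buffer
    then becomes [x] by recolouring [x c - x d] items from [d] to [c]. *)
Lemma wins_frequent r t x c d : x d <= x c ->
  wins r t x (Some d) <= wins r t x (Some c).
Proof.
move=> le_dc; have [->//|ncd] := eqVneq c d.
have -> : Some d = omap (tperm c d) (Some c) by rewrite /= tpermL.
rewrite -wins_rename.
set y := finfun _; have le_j : x c - x d <= y d by rewrite ffunE tpermR leq_subr.
apply: leq_trans (wins_recolourn _ _ ncd le_j) _.
rewrite leq_eqVlt; apply/orP; left; apply/eqP; congr (wins r t _ _).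
apply/ffunP => e; rewrite !ffunE.
case: (eqVneq e c) => [->|nec]; first by rewrite tpermL (negPf ncd); lia.
case: (eqVneq e d) => [->|ned]; first by rewrite tpermR; lia.
by rewrite tpermD 1?eq_sym //; lia.
Qed.

End OptimalCount.

(** * Counting sequences item by item *)

Section Tally.
Variable C : finType.

(** The recursion on the first item mirrors the sum over the entering item in [wins]. *)
Fixpoint tally r (P : pred (seq C)) : nat :=
  if r is r'.+1 then \sum_e tally r' (fun p => P (e :: p)) else P [::].

Lemma card_tuple_tally r (P : pred (seq C)) :
  #|[pred s : r.-tuple C | P s]| = tally r P.
Proof.
elim: r P => [|r IH] P.
  rewrite -sum1_card big_mkcond (bigD1 [tuple]) //= big1 => [|s]; last first.
    by move=> /eqP[]; exact: tuple0.
  by rewrite addn0 inE; case: (P _).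
transitivity (\sum_e #|[pred s : r.-tuple C | P (e :: s)]|); last first.
  by rewrite /=; apply: eq_bigr => e _; rewrite -IH.
rewrite -sum1_card.
under [RHS]eq_bigr => e _ do rewrite -sum1_card.
rewrite pair_big_dep /=.
rewrite (reindex (fun es : C * r.-tuple C => [tuple of es.1 :: es.2])) //=.
exists (fun s : r.+1.-tuple C => (thead s, [tuple of behead s])) => [[e s] _|s _] /=.
  by congr pair; apply: val_inj.
by rewrite [RHS]tuple_eta; apply: val_inj.
Qed.

Lemma leq_tally r (P Q : pred (seq C)) :
  (forall p, size p = r -> P p -> Q p) -> tally r P <= tally r Q.
Proof.
elim: r P Q => [|r IH] P Q PQ /=; first exact: leq_nat_of_bool (PQ [::] _).
by apply: leq_sum => e _; apply: IH => p sz; apply: PQ; rewrite /= sz.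
Qed.

Lemma eq_tally r (P Q : pred (seq C)) :
  (forall p, size p = r -> P p = Q p) -> tally r P = tally r Q.
Proof. by move=> PQ; apply/eqP; rewrite eqn_leq !leq_tally // => p /PQ ->. Qed.

Lemma tally_pred0 r : tally r pred0 = 0.
Proof. by elim: r => //= r IH; rewrite big1. Qed.

Lemma tally_predT r : tally r predT = #|C| ^ r.
Proof.
elim: r => //= r IH; rewrite expnS -sum_nat_const.
by apply: eq_bigr => e _.
Qed.

(** Serves to fix the items that fill the buffer before the first decision. *)
Lemma leq_tally_prefix j r (P Q : pred (seq C)) :
  (forall q, size q = j ->
     tally r (fun p => P (q ++ p)) <= tally r (fun p => Q (q ++ p))) ->
  tally (j + r) P <= tally (j + r) Q.
Proof.
elim: j P Q => [|j IH] P Q PQ; first exact: (PQ [::]).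
by rewrite addSn /=; apply: leq_sum => e _; apply: IH => q sz; apply: (PQ (e :: q)); rewrite /= sz.
Qed.

End Tally.

(** * Actual runs compared with [wins] *)

Definition switches (C : Type) (st : station C) : nat := count (@is_switch C) (past st).

Definition multiplicities (C : finType) (s : seq C) : {ffun C -> nat} :=
  [ffun c => count_mem c s].

Section Execution.
Variables (C : finType) (k : nat).
Hypothesis k_gt0 : 0 < k.
Implicit Types (st : station C) (f : station C -> action C) (p : seq C).

Lemma multiplicities_gt0 (s : seq C) c : (0 < multiplicities s c) = (c \in s).
Proof. by rewrite ffunE -has_count has_pred1. Qed.

Lemma available_can_serve st :
  available (multiplicities (buffer st)) (active st) = can_serve st.
Proof.
by rewrite /available /can_serve; case: active => // c; rewrite multiplicities_gt0.
Qed.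

Lemma multiplicities_rem (s : seq C) c e : c \in s ->
  multiplicities (rem c s ++ [:: e]) = replace_item (multiplicities s) c e.
Proof.
move=> cs; apply/ffunP => b; rewrite !ffunE count_cat count_rem cs /= addn0.
by rewrite ![_ == b]eq_sym.
Qed.

Lemma admit_items_full st p : (p = [::]) \/ size (buffer st) = k ->
  admit_items k (Config st p) = Config st p.
Proof.
case: st => a b en pa; rewrite /admit_items /= => -[->|->].
  by rewrite take_oversize // drop_oversize // !cats0.
by rewrite subnn take0 drop0 !cats0.
Qed.

Lemma finished_pending st e p : finished (Config st (e :: p)) = false.
Proof. by rewrite /finished andbF. Qed.

Definition after_serve st c e : station C :=
  Station (Some c) (rem c (buffer st) ++ [:: e]) (rcons (entered st) e)
    (rcons (past st) Serve).

Lemma step_serve f st c e p : f st = Serve -> active st = Some c ->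
  c \in buffer st -> size (buffer st) = k ->
  step k f (Config st (e :: p)) = Config (after_serve st c e) p.
Proof.
move=> fS ac cb sz; rewrite /step finished_pending fS /act ac /admit_items /=.
have -> : k - size (rem c (buffer st)) = 1 by rewrite size_rem // sz; lia.
by rewrite /= take0 drop0 /after_serve !cats1.
Qed.

Lemma size_after_serve st c e : c \in buffer st ->
  size (buffer (after_serve st c e)) = size (buffer st).
Proof. by move=> cb; rewrite size_cat size_rem //=; case: (buffer st) cb => //= b s _; lia. Qed.

Lemma switches_act st a : switches (act st a) = switches st + is_switch a.
Proof. by case: a => [|c]; rewrite /switches /= -cats1 count_cat /= addn0. Qed.

Lemma switches_after_serve st c e : switches (after_serve st c e) = switches st.
Proof. by rewrite -[LHS]/(switches (act st Serve)) switches_act addn0. Qed.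

Lemma step_switch f st c p : f st = Switch c -> ~~ finished (Config st p) ->
  (p = [::]) \/ size (buffer st) = k ->
  step k f (Config st p) = Config (act st (Switch c)) p.
Proof.
by move=> fS /negPf nf full; rewrite /step nf fS admit_items_full.
Qed.

Lemma iter_step_finished f m (cf : config C) : finished cf -> iter m (step k f) cf = cf.
Proof. by move=> fin; elim: m => //= m ->; rewrite /step fin. Qed.

Lemma switches_leq_iter f m (cf : config C) : switches cf <= switches (iter m (step k f) cf).
Proof.
elim: m => //= m; set cf' := iter _ _ _ => IH; apply: leq_trans IH _.
rewrite /step; case: ifP => // _; rewrite -[leqRHS]/(switches (act cf' (f cf'))).
by rewrite switches_act leq_addr.
Qed.

Lemma other_colours_rem (s : seq C) c :
  other_colours (multiplicities (rem c s)) (Some c) = other_colours (multiplicities s) (Some c).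
Proof.
apply: eq_card => e; rewrite !inE !ffunE; case: eqVneq => //= ne; congr (0 < _).
rewrite count_rem /=; suff -> : (c == e) = false by rewrite andbF subn0.
by apply: contra_neqF ne => /eqP ->.
Qed.

Lemma other_colours_switch_to x (a : option C) c : ~~ available x a -> 0 < x c ->
  other_colours x a = (other_colours x (Some c)).+1.
Proof.
move=> na xc; rewrite /other_colours (cardD1 c) !inE xc andbT.
have -> : Some c != a by apply: contraNneq na => <-.
rewrite add1n; congr _.+1; apply: eq_card => e; rewrite !inE -[Some e == Some c]/(e == c).
case: eqVneq => //= nec; case: posnP => [_|xe]; rewrite ?andbF // andbT.
by apply/negP => /eqP ea; rewrite -ea /= xe in na.
Qed.

Local Arguments iter : simpl never.

(** A serve follows the recursion of [wins], and any switch, even a needless one, is covered by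
    [wins_switch]. Runs unfinished after [m] steps are not counted, so every [m] will do. With a
    full buffer each serve admits exactly one pending item, as in [wins]. *)
Lemma tally_leq_wins f T m st r : (r = 0) \/ size (buffer st) = k ->
  tally r (fun p => let cf := iter m (step k f) (Config st p) in
                    finished cf && (switches cf <= T)) <=
  (if switches st <= T then
     wins r (T - switches st) (multiplicities (buffer st)) (active st) else 0).
Proof.
case: (leqP (switches st) T) => [le_T|gt_T] full; last first.
  rewrite -(tally_pred0 C r); apply: leq_tally => p _ /andP[_].
  by rewrite leqNgt (leq_trans gt_T (switches_leq_iter f m (Config st p))).
elim: m st r full le_T => [|m IH] st r full le_T.
  case: r full => [_|r [//|sz]] /=.
    apply: leq_nat_of_bool; rewrite /finished /= andbT => /andP[/nilP -> _].
    by rewrite /other_colours eq_card0 // => c; rewrite !inE ffunE andbF.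
  rewrite big1 // => e _; apply: etrans (tally_pred0 C r).
  by apply: eq_tally => p _; rewrite finished_pending.
have [/andP[/eqP r0 /nilP b0]|nfin] := boolP ((r == 0) && nilp (buffer st)).
  rewrite r0 /= b0; apply: leq_nat_of_bool => _.
  by rewrite /other_colours eq_card0 // => c; rewrite !inE ffunE andbF.
have nf p : size p = r -> ~~ finished (Config st p).
  by move=> sz; apply: contra nfin => /andP[/nilP /= -> /nilP p0]; rewrite -sz p0.
have full_p p : size p = r -> p = [::] \/ size (buffer st) = k.
  by move=> sz; case: full => [r0|]; [left; apply/nilP; rewrite /nilp sz r0 | right].
case fst : (f st) => [|c].
  have [cs|ncs] := boolP (can_serve st).
    case ac : (active st) (cs) => [c|]; rewrite /can_serve ac // => cb.
    case: r full {nfin} nf full_p => [_|r [//|sz]] nf full_p.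
      rewrite /= -other_colours_rem iterSr.
      have -> : step k f (Config st [::]) = Config (act st Serve) [::].
        by rewrite /step (negPf (nf _ _)) // fst admit_items_full //; left.
      have := IH (act st Serve) 0 (or_introl erefl).
      by rewrite switches_act addn0 /= ac; apply.
    rewrite wins_serve ?multiplicities_gt0 //=; apply: leq_sum => e _.
    have := IH (after_serve st c e) r; rewrite size_after_serve // multiplicities_rem // switches_after_serve.
    move=> /(_ (or_intror sz) le_T); apply: leq_trans; apply: leq_tally => p _.
    by rewrite iterSr (step_serve _ _ fst ac).
  (* As [f] is arbitrary, it may try to serve an absent colour; this only lengthens the history. *)
  have actS : buffer (act st Serve) = buffer st.
    rewrite /=; case ac : (active st) => [c|] //; apply: rem_id.
    by apply: contra ncs; rewrite /can_serve ac.
  have := IH (act st Serve) r; rewrite actS switches_act addn0.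
  move=> /(_ full le_T); apply: leq_trans; apply: leq_tally => p sz.
  rewrite iterSr /step (negPf (nf _ sz)) fst admit_items_full //.
  by rewrite actS; apply: full_p.
have stepE p : size p = r -> step k f (Config st p) = Config (act st (Switch c)) p.
  by move=> sz; apply: step_switch => //; [apply: nf | apply: full_p].
move: le_T; rewrite leq_eqVlt => /orP[/eqP eT|lt_T].
  rewrite (@leq_trans 0) // -(tally_pred0 C r); apply: leq_tally => p sz.
  rewrite iterSr stepE // => /andP[_].
  have := switches_leq_iter f m (Config (act st (Switch c)) p).
  rewrite switches_act /= addn1 eT => lt_T.
  by rewrite leqNgt lt_T.
have := IH (act st (Switch c)) r full; rewrite switches_act addn1 => /(_ lt_T).
move=> le_w; apply: leq_trans (leq_trans le_w _).
  by apply: leq_tally => p sz; rewrite iterSr stepE.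
(* The switch just made is the extra one that [wins_switch] trades for a change of active colour. *)
have -> : T - switches st = (T - (switches st).+1).+1 by lia.
exact: wins_switch.
Qed.

(* Greedy's choices are only constrained on reachable configurations, and an
   online algorithm cannot tell apart the configurations with the same visible
   part, whence the quantification over all [p] in the hypothesis. *)
Lemma wins_leq_tally (a0 : option C) (G : online_algorithm k a0) T m st r :
  greedy G -> (r = 0) \/ size (buffer st) = k ->
  (forall p, size p = r -> exists s j, run k a0 G s j = Config st p) ->
  switches st <= T ->
  wins r (T - switches st) (multiplicities (buffer st)) (active st) <=
  tally r (fun p => switches (iter m (step k G) (Config st p)) <= T).
Proof.
move=> hG; elim: m st r => [|m IH] st r full reach le_T.
  (* At [m = 0] no run has to be finished, so all continuations count and the trivial bound
     suffices. *)
  apply: leq_trans (wins_bound _ _ _ _) _; rewrite -tally_predT.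
  by apply: leq_tally.
have reachS p st' p' : size p = r -> step k G (Config st p) = Config st' p' ->
    exists s j, run k a0 G s j = Config st' p'.
  move=> sz stE; have [s [j runE]] := reach p sz; exists s, j.+1.
  by rewrite -stE -runE /run iterS.
have greedy_st p : size p = r -> ~~ finished (Config st p) ->
    if can_serve st then G st = Serve else exists2 c, G st = Switch c &
      forall d, count_mem d (buffer st) <= count_mem c (buffer st).
  by move=> sz nf; have [s [j runE]] := reach p sz; have := hG s j; rewrite runE; apply.
have [/andP[/eqP r0 /nilP b0]|nfin] := boolP ((r == 0) && nilp (buffer st)).
  rewrite r0 /=; apply: leq_nat_of_bool => _.
  by rewrite iter_step_finished // /finished /= b0.
have nf p : size p = r -> ~~ finished (Config st p).
  by move=> sz; apply: contra nfin => /andP[/nilP /= -> /nilP p0]; rewrite -sz p0.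
have full_p p : size p = r -> p = [::] \/ size (buffer st) = k.
  by move=> sz; case: full => [r0|]; [left; apply/nilP; rewrite /nilp sz r0 | right].
(* Some reachable configuration is needed to learn greedy's decision. For positive [r] the buffer is
   full and [0 < k], so it supplies a colour to build [p0] from. *)
have [p0 sz0] : exists p, size p = r.
  case: r full nfin {reach reachS greedy_st nf full_p} => [|r] full nfin; first by exists [::].
  case: full => // sz; case: (buffer st) sz => [|c s _]; first by move: k_gt0 => /[swap] <-.
  by exists (nseq r.+1 c); rewrite size_nseq.
have := greedy_st p0 sz0 (nf _ sz0).
have [cs gS|ncs [c gS maxc]] := boolP (can_serve st).
  case ac : (active st) (cs) => [c|]; rewrite /can_serve ac // => cb.
  case: r full {nfin greedy_st sz0} reachS nf full_p reach => [_|r [//|sz]] reachS nf full_p reach.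
    have stE : step k G (Config st [::]) = Config (act st Serve) [::].
      by rewrite /step (negPf (nf _ _)) // gS admit_items_full //; left.
    rewrite /= -other_colours_rem iterSr stE.
    have reach0 p : size p = 0 -> exists s j, run k a0 G s j = Config (act st Serve) p.
      by case: p => // _; apply: reachS stE.
    have := IH (act st Serve) 0 (or_introl erefl) reach0.
    by rewrite switches_act addn0 /= ac; apply.
  rewrite wins_serve ?multiplicities_gt0 //=; apply: leq_sum => e _.
  have stE p : step k G (Config st (e :: p)) = Config (after_serve st c e) p.
    by apply: step_serve.
  have := IH (after_serve st c e) r; rewrite size_after_serve // multiplicities_rem // switches_after_serve.
  move=> /(_ (or_intror sz)) le_w; apply: leq_trans (le_w _ le_T) _.
    by move=> p szp; apply: reachS (stE p); rewrite /= szp.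
  by apply: leq_tally => p _; rewrite iterSr stE.
have stE p : size p = r -> step k G (Config st p) = Config (act st (Switch c)) p.
  by move=> sz; apply: step_switch => //; [apply: nf | apply: full_p].
have cb : 0 < multiplicities (buffer st) c.
  have : 0 < size (buffer st).
    move: nfin; rewrite negb_and => /orP[nr|]; last by rewrite lt0n.
    by case: full nr => [->//|-> _].
  case: (buffer st) maxc => // d s maxc _; rewrite ffunE.
  by apply: leq_trans (maxc d); rewrite /= eqxx.
have nav : ~~ available (multiplicities (buffer st)) (active st).
  by rewrite available_can_serve.
(* Greedy's colour attains the maximum in [wins], by [wins_frequent]; with nothing pending, a switch
   to any buffered colour lowers [other_colours] by one. *)
have le_w : switches st < T ->
    wins r (T - switches st) (multiplicities (buffer st)) (active st) <=
    wins r (T - (switches st).+1) (multiplicities (buffer st)) (Some c).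
  move=> lt_T; have -> : T - switches st = (T - (switches st).+1).+1 by lia.
  case: (r) => [|r'].
    by rewrite /= (other_colours_switch_to nav cb); apply: leq_nat_of_bool.
  rewrite wins_stuck //; apply/bigmax_leqP => d _; apply: wins_frequent.
  by rewrite !ffunE.
move: le_T; rewrite leq_eqVlt => /orP[/eqP eT|lt_T].
  rewrite eT subnn; case: (r) => [|r']; last by rewrite wins_stuck.
  by rewrite /= (other_colours_switch_to nav cb).
apply: leq_trans (le_w lt_T) _.
have := IH (act st (Switch c)) r full; rewrite switches_act addn1 => le_t.
apply: leq_trans (le_t _ lt_T) _; first by move=> p sz; apply: reachS sz (stE p sz).
by apply: leq_tally => p sz; rewrite iterSr stE.
Qed.

(** A finished configuration is a fixed point of [step], so the cost can be read at any later
    time. *)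
Lemma cost_run (a0 : option C) (A : online_algorithm k a0) s m :
  ex_minn (decide_serves_all A s) <= m ->
  finished (run k a0 A s m) /\ cost A s = switches (run k a0 A s m).
Proof.
rewrite /cost; case: ex_minnP => i fin _ /subnK <-.
by rewrite {1 3}/run iterD -/(run k a0 A s i) iter_step_finished.
Qed.

Lemma start_cat (a0 : option C) q p : (p = [::] /\ size q <= k) \/ size q = k ->
  start k a0 (q ++ p) = Config (Station a0 q q [::]) p.
Proof.
rewrite /start /admit_items /= subn0 => -[[-> le_q]|<-].
  by rewrite cats0 take_oversize // drop_oversize.
by rewrite take_size_cat // drop_size_cat.
Qed.

End Execution.

(** * Comparison of greedy with an arbitrary online algorithm *)

Theorem theorem4 (C : finType) (k : nat) (hk : 0 < k) (a0 : option C)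
    (G : online_algorithm k a0) (hG : greedy G)
    (n : nat) (B : online_algorithm k a0) :
  exists pi : n.-tuple C -> n.-tuple C,
    bijective pi /\ forall s : n.-tuple C, cost G s <= cost B (pi s).
Proof.
apply: (@bijection_of_dominated_levels _ (fun s : n.-tuple C => cost G s)
                                         (fun s : n.-tuple C => cost B s)) => T.
(* As there are finitely many inputs of length [n], a single time [m] suffices for both algorithms
   on all of them. *)
pose time (A : online_algorithm k a0) (s : n.-tuple C) := ex_minn (decide_serves_all A s).
pose m := maxn (\max_s time G s) (\max_s time B s).
have costG (s : n.-tuple C) : cost G s = switches (run k a0 G s m).
  apply: (cost_run _).2; apply: leq_trans (leq_maxl _ _).
  exact: (leq_bigmax (F := time G)).
have costB (s : n.-tuple C) : finished (run k a0 B s m) /\ cost B s = switches (run k a0 B s m).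
  apply: cost_run; apply: leq_trans (leq_maxr _ _).
  exact: (leq_bigmax (F := time B)).
pose okG s := switches (run k a0 G s m) <= T.
pose okB s := finished (run k a0 B s m) && (switches (run k a0 B s m) <= T).
rewrite (eq_card (B := [pred s : n.-tuple C | okB s])); last first.
  by move=> s; rewrite !inE /okB; have [-> ->] := costB s.
rewrite [leqRHS](eq_card (B := [pred s : n.-tuple C | okG s])); last first.
  by move=> s; rewrite !inE /okG -costG.
rewrite !card_tuple_tally.
(* The first [minn n k] items enter before any decision; afterwards the buffer is full or nothing is
   pending. *)
have -> : n = minn n k + (n - minn n k) by lia.
set r := n - _; apply: leq_tally_prefix => q szq.
have full : r = 0 \/ size q = k by rewrite szq /r; lia.
have startE p : size p = r -> start k a0 (q ++ p) = Config (Station a0 q q [::]) p.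
  move=> szp; apply: start_cat; case: full => [r0|]; last by right.
  by left; split; [apply/nilP; rewrite /nilp szp r0 | rewrite szq geq_minr].
apply: (@leq_trans (wins r T (multiplicities q) a0)).
  have := @tally_leq_wins C k hk B T m (Station a0 q q [::]) r full.
  rewrite /= subn0; apply: leq_trans; apply: leq_tally => p szp.
  by rewrite /okB /run startE.
have := @wins_leq_tally C k hk a0 G T m (Station a0 q q [::]) r hG full.
rewrite /= subn0 => le_w; apply: leq_trans (le_w _ isT) _.
  by move=> p szp; exists (q ++ p), 0; rewrite /run /= startE.
by apply: leq_tally => p szp; rewrite /okG /run startE.
Qed.
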